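(* Let $n\ge2$ and let $\tau$ be a partition of $\{1,\dots,n\}$ in which $n$ is not in a singleton part. Then the $G$-$G'$-polynomial for $\frac{Z[\tau]}{Z[1,2,\dots,n]}$ on annular-one graphs with $n$ nodes is invariant, as a polynomial in formal variables, under replacing each $G'_{i,j}$ with $G'_{i,j}+f(i)-f(j)$, for every function $f$ on $\{1,\dots,n-1\}$.
   Context: **Annular-one graphs and $Z$.** An annular-one graph is a finite connected graph $\mathcal G$ with positive edge weights, embedded in an annulus, with distinguished vertices (nodes) $1,\dots,n$ such that $1,\dots,n-1$ lie in this cyclic order on one boundary of the annulus and $n$ lies on the other boundary. For a set partition $\sigma$ of a subset of the nodes (the listed nodes), $Z[\sigma]$ is the sum, over spanning forests in which every tree contains at least one listed node and in which the partition of the listed nodes according to trees is $\sigma$, of the product of the edge weights (unlisted nodes are treated like non-node vertices). $Z[1,2,\dots,n]$ is the weighted sum of spanning trees. A partial pairing is such a $\sigma$ all of whose parts are pairs or singletons; its unlisted nodes are called internalized. **The $G$-$G'$-polynomial.** Consider formal commuting variables $G_{i,j}=G_{j,i}$ and $G'_{i,j}=-G'_{j,i}$, $1\le i,j\le n-1$. (On an actual graph they take the values $G_{i,j}=\mathscr G_{i,j}(1)$, $G'_{i,j}=\frac{d}{dz}\mathscr G_{i,j}(z)|_{z=1}$, where $\mathscr G(z)$ is the line-bundle Green's function with sink $n$.) On annular-one graphs $Z[\tau]$ is a linear combination $Z[\tau]=\sum_\rho c_\rho Z[\rho]$, with integer coefficients $c_\rho$ depending only on $\tau$ (not on the graph),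 of partial pairings $\rho$ that are planar in the annulus and have $n$ in a doubleton part. The $G$-$G'$-polynomial for $Z[\tau]/Z[1,2,\dots,n]$ is the polynomial $$\sum_\rho c_\rho\sum_{\mu\succeq\lambda(\rho)}N(\lambda(\rho)^\circ/\mu^\circ)\,\operatorname{Pf}M^{(G)}_\mu$$ in these formal variables, with the following notation. **Encoding string.** A labeled string is a sequence of symbols, each carrying a label. $\lambda(\rho)$ is the string of $n$ symbols, position $i$ having label $i$: node $n$ gets $\odot$; the node paired with $n$ gets $\mathsf F$; internalized nodes get $\mathsf I$; singletons get $\mathsf S$; the remaining nodes get $\mathsf U$ or $\mathsf D$ so that, after cyclically rotating so that $\mathsf F$ is at the end, the substring $\lambda^\circ$ of $\mathsf U$'s and $\mathsf D$'s is a Dyck path whose associated noncrossing matching is the pairing of these nodes in $\rho$. Such strings are labeled augmented cyclic Dyck paths. Write $\mu\succeq\lambda$ if $\lambda,\mu$ have the same length and labels, agree at all letters other than $\mathsf U,\mathsf D$, and the Dyck path $\lambda^\circ$ lies weakly below $\mu^\circ$. **Matrix.** Let $f_\mu$ be the label of the unique $\mathsf F$ in $\mu$. The string $\overline\mu$ is obtained from $\mu$ by deleting all $\mathsf I$ letters, replacing each $\mathsf S$ labeled $i$ by the two letters $\bigcirc\,\odot$ (in this order), both labeled $i$, and then, keeping labels: $\mathsf U$ labeled $i$ becomes $\oplus$ if $i<f_\mu$ and $\bigcirc$ if $i>f_\mu$; $\mathsf D$ labeled $i$ becomes $\bigcirc$ if $i<f_\mu$ and $\ominus$ if $i>f_\mu$;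 $\mathsf F$ becomes $\bigcirc$. Let $\sigma=\overline\mu$, of length $m$, with $i$th symbol $\sigma_i$ and $i$th label $\sigma(i)$. $M^{(G)}_\mu$ is the antisymmetric $m\times m$ matrix with $(i,j)$ entry - $-G'_{\sigma(i),\sigma(j)}+G_{\sigma(i),\sigma(j)}(1_{\sigma_i=\oplus}-1_{\sigma_j=\oplus}-1_{\sigma_i=\ominus}+1_{\sigma_j=\ominus})$ if $\sigma_i,\sigma_j\ne\odot$; - $G_{\sigma(i),\sigma(j)}$ if $\sigma_i\ne\odot$, $\sigma_j=\odot$; - $-G_{\sigma(i),\sigma(j)}$ if $\sigma_i=\odot$, $\sigma_j\ne\odot$; - $0$ if $\sigma_i=\sigma_j=\odot$, where each $G_{i,n}$ and $G_{n,i}$ is replaced with $1$. **Dyck tilings.** $N(\lambda^\circ/\mu^\circ)$ is the number of cover-inclusive Dyck tilings of the skew shape $\lambda^\circ/\mu^\circ$ between the two Dyck paths, made of $\sqrt2\times\sqrt2$ boxes rotated $45^\circ$. A Dyck tile is a ribbon of such boxes centered at the points of a translated Dyck path (possibly of length $0$); a tile $T_1$ covers $T_2$ if $T_1$ contains a box directly above a box of $T_2$; a tiling by Dyck tiles is cover-inclusive if whenever $T_1$ covers $T_2$ the range of $x$-coordinates of $T_1$ is a subset of that of $T_2$. *)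

(* Defs.v *)
From HB Require Import structures.
From mathcomp Require Import all_boot all_order all_algebra all_fingroup.
From mathcomp Require Import reals.
From mathcomp Require Import mpoly.

Set Implicit Arguments.
Unset Strict Implicit.
Unset Printing Implicit Defensive.

Import Order.TTheory GRing.Theory Num.Theory.
Local Open Scope ring_scope.

(* Throughout, n = m + 1.  A node is an element of 'I_m.+1: the ordinal i
   stands for node i + 1, so node n is [ord_max], and the nodes 1, ..., n - 1
   are the [lift ord_max i] with i : 'I_m. *)

(** * Annular-one graphs *)

(* A connected graph (multiple edges and loops allowed) embedded in an annulus
   is encoded by the rotation system obtained by gluing a disc to each boundary
   of the annulus: [ag_vert] turns a dart around its initial vertex, [ag_edge]
   reverses a dart, and the vertices, edges and faces of the resulting map on
   the sphere are the orbits of [ag_vert], [ag_edge] and [ag_face].  A dart d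
   also stands for the corner of the face [porbit ag_face d] at the initial
   vertex of d.

   Node i touches its boundary circle at the corner [ag_corner i].  The circle
   of nodes 1, ..., n - 1 lies in a single face, whose contour visits their
   corners in this cyclic order.  The other circle lies in the face of the
   corner of n.  Nothing else is required of that face: it may be any face,
   including the one that contains the first circle, since disjoint discs
   reaching distinct corners of one face always exist.  Reversing all
   rotations mirrors the embedding, so one orientation of the cyclic order
   suffices. *)
Record annular_one (R : realType) (m : nat) := AnnularOne {
  ag_dart : finType;
  ag_vert : {perm ag_dart};
  ag_edge : {perm ag_dart};
  ag_face : {perm ag_dart} := (ag_edge * ag_vert)%g;
  ag_weight : {set ag_dart} -> R;
  ag_corner : 'I_m.+1 -> ag_dart;
  ag_edge_neq : forall d, ag_edge d != d;
  ag_edge_inv : forall d, ag_edge (ag_edge d) = d;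
  ag_connected : forall d d',
    connect (fun x y => (y == ag_vert x) || (y == ag_edge x)) d d';
  (* Euler's formula: the map is on the sphere. *)
  ag_planar : (#|porbits ag_vert| + #|porbits ag_face|
               = #|porbits ag_edge| + 2)%N;
  ag_weight_gt0 : forall E, E \in porbits ag_edge -> 0 < ag_weight E;
  ag_corner_inj : injective (fun i => porbit ag_vert (ag_corner i));
  ag_same_face : forall i j : 'I_m,
    fconnect ag_face (ag_corner (lift ord_max i)) (ag_corner (lift ord_max j));
  ag_cyclic : forall i j k : 'I_m, (i < j < k)%N ->
    (findex ag_face (ag_corner (lift ord_max i)) (ag_corner (lift ord_max j))
     < findex ag_face (ag_corner (lift ord_max i))
                      (ag_corner (lift ord_max k)))%N
}.

Arguments ag_weight {R m} _ _.

Section Forests.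

Variables (R : realType) (m : nat) (g : annular_one R m).

(* The initial vertices of x and y are joined by a path using only edges in
   the set F of edges. *)
Definition joined (F : {set {set ag_dart g}}) : rel (ag_dart g) :=
  connect (fun x y => (y \in porbit (ag_vert g) x)
    || ((y == ag_edge g x) && (porbit (ag_edge g) x \in F))).

(* Acyclicity: no edge x of F lies on a cycle of F. *)
Definition is_forest (F : {set {set ag_dart g}}) : bool :=
  (F \subset porbits (ag_edge g)) &&
  [forall x, (porbit (ag_edge g) x \in F) ==>
     ~~ joined (F :\ porbit (ag_edge g) x) x (ag_edge g x)].

Definition spans_nodes (F : {set {set ag_dart g}}) (L : {set 'I_m.+1}) : bool :=
  [forall x, [exists i in L, joined F x (ag_corner g i)]].

Definition node_partition (F : {set {set ag_dart g}}) (L : {set 'I_m.+1}) :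
    {set {set 'I_m.+1}} :=
  equivalence_partition (fun i j => joined F (ag_corner g i) (ag_corner g j)) L.

(* The listed nodes of sigma are those of [cover sigma]. *)
Definition Zsum (sigma : {set {set 'I_m.+1}}) : R :=
  \sum_(F | [&& is_forest F, spans_nodes F (cover sigma)
              & node_partition F (cover sigma) == sigma])
    \prod_(E in F) ag_weight g E.

End Forests.

(** * Partial pairings *)

Section Pairings.

Variable m : nat.
Implicit Types rho : {set {set 'I_m.+1}}.

Definition partial_pairing rho : bool :=
  trivIset rho && [forall B in rho, (0 < #|B| <= 2)%N].

Definition last_in_doubleton rho : bool :=
  [exists B in rho, (ord_max \in B) && (#|B| == 2)].

(* When n is paired, cutting the annulus along the chord of n leaves a disc, so
   rho is planar in the annulus iff its pairs inside {1, ..., n - 1} do not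
   cross as chords of a circle; the chord of n gives no further constraint,
   since the other chords can go around the hole on either side. *)
Definition annular_planar rho : bool :=
  [forall a : 'I_m.+1, forall b : 'I_m.+1, forall c : 'I_m.+1,
   forall d : 'I_m.+1,
     [&& [set a; b] \in rho, [set c; d] \in rho & d != ord_max] ==>
     ~~ [&& a < c, c < b & b < d]%N].

Definition planar_pairing rho : bool :=
  [&& partial_pairing rho, last_in_doubleton rho & annular_planar rho].

Definition partner rho (i : 'I_m.+1) : 'I_m.+1 :=
  odflt i [pick j | (j != i) && ([set i; j] \in rho)].

End Pairings.

(** * Labeled augmented cyclic Dyck paths *)

Inductive letter := LU | LD | LF | LS | LI | Lsink.

Definition letter_code (a : letter) : 'I_6 :=
  match a with
  | LU => inord 0 | LD => inord 1 | LF => inord 2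
  | LS => inord 3 | LI => inord 4 | Lsink => inord 5
  end.

Definition letter_decode (k : 'I_6) : letter :=
  match val k with
  | 0 => LU | 1 => LD | 2 => LF | 3 => LS | 4 => LI | _ => Lsink
  end%N.

Lemma letter_codeK : cancel letter_code letter_decode.
Proof. by case; rewrite /letter_decode /= inordK. Qed.

HB.instance Definition _ := Finite.copy letter (can_type letter_codeK).

Definition is_UD (a : letter) : bool := (a == LU) || (a == LD).

(* A path is a sequence of steps, [true] for up and [false] for down.  The
   truncated subtraction in [height] is exact on Dyck paths. *)
Definition height (w : seq bool) (x : nat) : nat :=
  (count id (take x w) - count negb (take x w))%N.

Definition is_dyck (w : seq bool) : bool :=
  (count id w == count negb w) &&
  all (fun x => count negb (take x w) <= count id (take x w))%N
      (iota 0 (size w).+1).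

Definition weakly_below (w1 w2 : seq bool) : bool :=
  (size w1 == size w2) &&
  all (fun x => height w1 x <= height w2 x)%N (iota 0 (size w1).+1).

Section Strings.

Variable m : nat.

(* The letter at position i has label i. *)
Notation lstring := ((m.+1).-tuple letter).

(* Position of i in the order f + 1, ..., n, 1, ..., f. *)
Definition cyc_pos (f i : 'I_m.+1) : nat :=
  index i (rot f.+1 (enum 'I_m.+1)).

Definition letter_of (rho : {set {set 'I_m.+1}}) (i : 'I_m.+1) : letter :=
  let f := partner rho ord_max in
  if i == ord_max then Lsink
  else if i == f then LF
  else if i \notin cover rho then LI
  else if [set i] \in rho then LS
  else if (cyc_pos f i < cyc_pos f (partner rho i))%N then LU else LD.

Definition encoding (rho : {set {set 'I_m.+1}}) : lstring :=
  [tuple letter_of rho i | i < m.+1].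

(* f_mu *)
Definition F_label (mu : lstring) : nat := index LF mu.

(* mu^o *)
Definition dyck_part (mu : lstring) : seq bool :=
  [seq a == LU | a <- rot (F_label mu).+1 mu & is_UD a].

Definition aug_cyclic_dyck (mu : lstring) : bool :=
  [&& tnth mu ord_max == Lsink, count_mem Lsink mu == 1%N,
      count_mem LF mu == 1%N & is_dyck (dyck_part mu)].

Definition succeq (mu lam : lstring) : bool :=
  [&& aug_cyclic_dyck mu,
      [forall i, (is_UD (tnth mu i) && is_UD (tnth lam i))
                 || (tnth mu i == tnth lam i)]
    & weakly_below (dyck_part lam) (dyck_part mu)].

End Strings.

(** * Dyck tilings *)

Section DyckTilings.

Variables lo up : seq bool.

(* A box is given by its center (x, y), the paths starting at (0, 0) with steps
   (1, 1) and (1, -1); its corners are (x +- 1, y) and (x, y +- 1).  The boxes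
   between two Dyck paths have both coordinates at most the length. *)
Local Notation box := ('I_(size lo).+1 * 'I_(size lo).+1)%type.

Definition skew_shape : {set box} :=
  [set b : box | odd (b.1 + b.2) && (height lo b.1 < b.2 < height up b.1)%N].

Definition ribbon (x0 y0 : nat) (w : seq bool) : seq (nat * nat) :=
  [seq (x0 + x, y0 + height w x)%N | x <- iota 0 (size w).+1].

Definition is_dyck_tile (T : {set box}) : bool :=
  [exists x0 : 'I_(size lo).+1, exists y0 : 'I_(size lo).+1,
   exists l : 'I_(size lo).+1, exists w : l.-tuple bool,
     is_dyck w &&
     perm_eq [seq (val b.1, val b.2) | b <- enum T] (ribbon x0 y0 w)].

Definition covers (T1 T2 : {set box}) : bool :=
  [exists b1 in T1, exists b2 in T2,
     (b1.1 == b2.1) && (val b1.2 == b2.2 + 2)%N].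

Definition cover_inclusive (P : {set {set box}}) : bool :=
  [forall T1 in P, forall T2 in P, covers T1 T2 ==>
     ([set b.1 | b in T1] \subset [set b.1 | b in T2])].

Definition num_dyck_tilings : nat :=
  #|[set P : {set {set box}} |
      [&& partition P skew_shape, [forall T in P, is_dyck_tile T]
        & cover_inclusive P]]|.

End DyckTilings.

(** * Pfaffians *)

(* Sum over the permutations s with s 0 < s 1, s 2 < s 3, ... and
   s 0 < s 2 < s 4 < ..., which list each perfect matching once; [ordS i] is
   i + 1 for even i when p is even. *)
Definition pfaffian (K : comNzRingType) (p : nat) (M : 'M[K]_p) : K :=
  if odd p then 0 else
  \sum_(s : 'S_p |
      [forall i : 'I_p, ~~ odd i ==> (s i < s (ordS i))%N] &&
      [forall i : 'I_p, forall j : 'I_p,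
         [&& ~~ odd i, ~~ odd j & i < j]%N ==> (s i < s j)%N])
    (-1) ^+ s * \prod_(i : 'I_p | ~~ odd i) M (s i) (s (ordS i)).

(** * The G-G'-polynomial *)

Section GGPolynomial.

Variables (K : comNzRingType) (m : nat).

(* The independent variables are the G_{i,j} with i <= j and the G'_{i,j} with
   i < j; the remaining ones are given by the (anti)symmetry relations. *)
Definition gvar : finType :=
  ({ij : 'I_m * 'I_m | (ij.1 <= ij.2)%N} +
   {ij : 'I_m * 'I_m | (ij.1 < ij.2)%N})%type.

Notation gpoly := {mpoly K[#|gvar|]}.

Definition gvarX (v : gvar) : gpoly := 'X_(enum_rank v).

Definition Gvar (i j : 'I_m) : gpoly :=
  if insub (i, j) is Some v then gvarX (inl v)
  else if insub (j, i) is Some v then gvarX (inl v) else 0.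

Definition Gpvar (i j : 'I_m) : gpoly :=
  if insub (i, j) is Some v then gvarX (inr v)
  else if insub (j, i) is Some v then - gvarX (inr v) else 0.

Definition Gnode (i j : 'I_m.+1) : gpoly :=
  match unlift ord_max i, unlift ord_max j with
  | Some i', Some j' => Gvar i' j'
  | _, _ => 1
  end.

(* The label n only occurs on the letter of node n, whose matrix entries do not
   involve G', so the default value is never used. *)
Definition Gpnode (i j : 'I_m.+1) : gpoly :=
  match unlift ord_max i, unlift ord_max j with
  | Some i', Some j' => Gpvar i' j'
  | _, _ => 0
  end.

Inductive symbol := Oplus | Ominus | Ocirc | Odot.

Definition is_plus (a : symbol) : bool := if a is Oplus then true else false.
Definition is_minus (a : symbol) : bool := if a is Ominus then true else false.

Definition expand_letter (f : nat) (a : letter) (i : 'I_m.+1) :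
    seq (symbol * 'I_m.+1) :=
  match a with
  | LI => [::]
  | LS => [:: (Ocirc, i); (Odot, i)]
  | LU => [:: (if (i < f)%N then Oplus else Ocirc, i)]
  | LD => [:: (if (i < f)%N then Ocirc else Ominus, i)]
  | LF => [:: (Ocirc, i)]
  | Lsink => [:: (Odot, i)]
  end.

(* The string written mu with an overline. *)
Definition bar_string (mu : (m.+1).-tuple letter) : seq (symbol * 'I_m.+1) :=
  flatten [seq expand_letter (F_label mu) (tnth mu i) i | i <- enum 'I_m.+1].

Definition Gentry (a b : symbol * 'I_m.+1) : gpoly :=
  match a.1, b.1 with
  | Odot, Odot => 0
  | Odot, _ => - Gnode a.2 b.2
  | _, Odot => Gnode a.2 b.2
  | _, _ =>
      - Gpnode a.2 b.2
      + Gnode a.2 b.2 * ((is_plus a.1)%:R - (is_plus b.1)%:R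
                         - (is_minus a.1)%:R + (is_minus b.1)%:R)
  end.

Definition Gmatrix (mu : (m.+1).-tuple letter) :
    'M[gpoly]_(size (bar_string mu)) :=
  \matrix_(i, j) Gentry (tnth (in_tuple (bar_string mu)) i)
                        (tnth (in_tuple (bar_string mu)) j).

(* The G-G'-polynomial of the combination sum_rho (c rho) Z[rho]. *)
Definition GG_polynomial (c : {set {set 'I_m.+1}} -> int) : gpoly :=
  \sum_(rho | planar_pairing rho)
    (c rho)%:~R *
    \sum_(mu : (m.+1).-tuple letter | succeq mu (encoding rho))
      (num_dyck_tilings (dyck_part (encoding rho)) (dyck_part mu))%:R *
      pfaffian (Gmatrix mu).

(* G'_{i,j} := G'_{i,j} + f i - f j *)
Definition shift_var (f : 'I_m -> K) (v : gvar) : gpoly :=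
  match v with
  | inl _ => gvarX v
  | inr ij => gvarX v + (f (val ij).1)%:MP - (f (val ij).2)%:MP
  end.

Definition shift_Gp (f : 'I_m -> K) (p : gpoly) : gpoly :=
  p \mPo [tuple shift_var f (enum_val k) | k < #|gvar|].

End GGPolynomial.

(* c expresses Z[tau] through the planar partial pairings with n in a
   doubleton, uniformly over all annular-one graphs. *)
Definition annular_expansion (R : realType) (m : nat)
    (tau : {set {set 'I_m.+1}}) (c : {set {set 'I_m.+1}} -> int) : Prop :=
  forall g : annular_one R m,
    Zsum g tau = \sum_(rho | planar_pairing rho) (c rho)%:~R * Zsum g rho.

(* Main.v *)
Require Import Defs.
From mathcomp Require Import all_boot all_order all_algebra all_fingroup.
From mathcomp Require Import reals.
From mathcomp Require Import mpoly.
From mathcomp Require Import zify ring.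

(** The invariance holds for each Pfaffian [pfaffian (Gmatrix K mu)]
    separately, whatever the coefficients [c].  The bar string of mu contains
    the symbol of the sink, a dotted symbol labelled n.  Its row in the matrix
    is -1 at every undotted symbol and 0 at every dotted one, because each
    G_{n,i} is replaced with 1.  Replacing G'_{i,j} with G'_{i,j} + f(i) - f(j)
    subtracts f(i) - f(j) from the entries between two undotted symbols and
    changes nothing else, and this is the same as adding, for each undotted
    symbol labelled i, f(i) times the row of the sink to the row of the symbol
    and f(i) times the column of the sink to its column ([shift_Gentry]).
    Such a unimodular congruence preserves the Pfaffian
    ([pfaffian_add_multiples]).

    That last fact is proved for alternating matrices over any commutative
    ring, where one may not divide by 2, so the Pfaffian is kept as a sum with
    one permutation for each perfect matching, the normal one.  Its summands
    depend only on the matching, every permutation can be normalized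
    ([normalize_pairing]), and in only one way ([normal_pair_uniq]).  Hence
    left composition with a transposition, followed by normalization, is an
    involution of the normal permutations, and if the two rows transposed are
    equal it reverses signs: the Pfaffian of an alternating matrix with two
    equal rows vanishes ([pfaffian_eq_rows]).  Since each summand is linear in
    any given row and column taken together, congruence by a transvection
    preserves the Pfaffian ([pfaffian_transvection]), and the general case
    follows one row at a time. *)

Set Implicit Arguments.
Unset Strict Implicit.
Unset Printing Implicit Defensive.

Import GRing.Theory.
Local Open Scope ring_scope.

(** * Sign-reversing involutions *)

(** A sum equal to its own opposite need not vanish when 2 is a zero divisor,
    so the terms off the fixed points are cancelled in pairs: the order of the
    finite type singles out one element of each two-element orbit. *)
Lemma sum_sign_reversing (T : finType) (V : zmodType) (P : pred T)
    (iota : T -> T) (F : T -> V) :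
    {homo iota : x / P x} -> {in P, involutive iota} ->
    {in P, forall x, F (iota x) = - F x} ->
    {in P, forall x, iota x = x -> F x = 0} ->
  \sum_(x | P x) F x = 0.
Proof.
move=> Piota iotaK Fiota F0.
rewrite (bigID (fun x => iota x == x)) /= big1 => [|x /andP[Px /eqP]]; last first.
  exact: F0.
rewrite add0r (bigID (fun x => enum_rank x < enum_rank (iota x))%N) /=.
rewrite [X in _ + X](reindex_onto iota iota) => [|x /andP[/andP[/iotaK]]//] /=.
rewrite -[RHS](subrr (\sum_(x | P x && (iota x != x)
                           && (enum_rank x < enum_rank (iota x))%N) F x)).
congr (_ + _); rewrite -sumrN; apply: eq_big => [x|x]; last first.
  case/andP=> /andP[/andP[Px _] _] /eqP ixx; apply: Fiota.
  by rewrite unfold_in -ixx; apply: Piota.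
apply/idP/idP => [/andP[/andP[/andP[Px neq] le] /eqP ixx]|].
  move: neq le; rewrite ixx -[P x]/(P x) => neq le.
  have -> : P x by rewrite -ixx; apply: Piota.
  rewrite eq_sym neq /= ltn_neqAle leqNgt le andbT.
  by apply: contra neq => /eqP/val_inj/enum_rank_inj<-.
case/andP=> /andP[Px neq] lt; rewrite iotaK // eqxx Piota // eq_sym neq /=.
by rewrite -leqNgt ltnW.
Qed.

(** * Permutations representing perfect matchings *)

Section Pfaffian.

Variable p : nat.
Hypothesis p_even : ~~ odd p.
Implicit Types (i j k : 'I_p) (s h : 'S_p).

(** A permutation s represents the matching with pairs {s i, s (mate i)}.  Two
    permutations represent the same matching iff they differ by a
    permutation of the positions that commutes with [mate]. *)
Definition mate i : 'I_p := if odd i then ord_pred i else ordS i.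

Lemma val_mate i : mate i = (if odd i then i.-1 else i.+1) :> nat.
Proof.
rewrite /mate; case: ifP => odd_i /=.
  have -> : (i + p).-1 = (i.-1 + p)%N by lia.
  by rewrite modnDr modn_small; have := ltn_ord i; lia.
by rewrite modn_small; have := ltn_ord i; lia.
Qed.

Lemma mateK : involutive mate.
Proof.
move=> i; apply: ord_inj; rewrite !val_mate.
by case: (ifP (odd i)) => oi; case: ifP; lia.
Qed.

Lemma odd_mate i : odd (mate i) = ~~ odd i.
Proof. by rewrite val_mate; case: ifP; lia. Qed.

Lemma ordS_mate i : ~~ odd i -> ordS i = mate i.
Proof. by rewrite /mate => /negbTE->. Qed.

Lemma mate_inj : injective mate. Proof. exact: inv_inj mateK. Qed.

Lemma mate_neq i : i != mate i.
Proof. by apply/eqP=> /(congr1 (odd \o val)) /=; rewrite odd_mate; case: odd. Qed.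

(** The condition selecting the summands of [pfaffian]. *)
Definition normal s : bool :=
  [forall i : 'I_p, ~~ odd i ==> (s i < s (ordS i))%N] &&
  [forall i : 'I_p, forall j : 'I_p,
     [&& ~~ odd i, ~~ odd j & i < j]%N ==> (s i < s j)%N].

Lemma normalP s :
  reflect ((forall i, ~~ odd i -> s i < s (mate i))%N /\
           (forall i j, ~~ odd i -> ~~ odd j -> i < j -> s i < s j)%N)
          (normal s).
Proof.
apply: (iffP andP) => [][s_up s_incr]; split.
- by move=> i ei; move: (forallP s_up i); rewrite ei ordS_mate.
- move=> i j ei ej ltij.
  by move/forallP/(_ j): (forallP s_incr i); rewrite ei ej ltij.
- by apply/forallP=> i; apply/implyP=> ei; rewrite ordS_mate ?s_up.
- apply/forallP=> i; apply/forallP=> j; apply/implyP=> /and3P[]; exact: s_incr.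
Qed.

Definition pair_perm h : bool := [forall i, h (mate i) == mate (h i)].

Lemma pair_permP h : reflect (forall i, h (mate i) = mate (h i)) (pair_perm h).
Proof. apply: (iffP forallP) => hM i; apply/eqP; exact: hM. Qed.

Lemma pair_perm1 : pair_perm 1.
Proof. by apply/pair_permP => i; rewrite !perm1. Qed.

Lemma pair_permM h h' : pair_perm h -> pair_perm h' -> pair_perm (h * h').
Proof.
move=> /pair_permP hM /pair_permP hM'; apply/pair_permP=> i.
by rewrite !permM hM hM'.
Qed.

Lemma pair_permV h : pair_perm h -> pair_perm h^-1.
Proof.
move=> /pair_permP hM; apply/pair_permP=> i.
by apply: (@perm_inj _ h); rewrite permKV hM permKV.
Qed.

Lemma pair_perm_flip i : pair_perm (tperm i (mate i)).
Proof.
by apply/pair_permP=> k; rewrite (inj_tperm _ _ _ mate_inj) mateK tpermC.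
Qed.

Definition swap_pairs i j : 'S_p := (tperm i j * tperm (mate i) (mate j))%g.

Lemma even_neq_mate i j : ~~ odd i -> ~~ odd j -> i != mate j.
Proof.
by move=> ei ej; apply: contraNneq ei => ->; rewrite odd_mate.
Qed.

Lemma swap_pairs_even i j k :
  ~~ odd i -> ~~ odd j -> ~~ odd k -> swap_pairs i j k = tperm i j k.
Proof.
move=> ei ej ek; rewrite permM [LHS]tpermD // eq_sym even_neq_mate //;
  by case: tpermP => // ->.
Qed.

Lemma pair_perm_swap i j :
  ~~ odd i -> ~~ odd j -> pair_perm (swap_pairs i j).
Proof.
move=> ei ej.
have comm : commute (tperm i j) (tperm (mate i) (mate j)).
  apply/commgP/conjg_fixP.
  by rewrite tpermJ !tpermD // eq_sym even_neq_mate.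
apply/pair_permP=> k; rewrite [in RHS]/swap_pairs comm /swap_pairs !permM.
have mateA x : tperm i j (mate x) = mate (tperm (mate i) (mate j) x).
  by rewrite (inj_tperm _ _ _ mate_inj) !mateK.
by rewrite mateA -(inj_tperm _ _ _ mate_inj).
Qed.

(** If h exchanged the two positions of some pair, s and h * s could not both
    increase along that pair, so h maps even positions to even positions.  It
    is increasing there, as s and h * s both are, and an increasing map from
    the even positions to themselves cannot decrease any of them. *)
Lemma normal_pair_ge s h i :
    pair_perm h -> normal s -> normal (h * s) -> ~~ odd i ->
  ~~ odd (h i) /\ (i <= h i)%N.
Proof.
move=> /pair_permP hM /normalP[s_up s_incr] /normalP[hs_up hs_incr].
have h_even k : ~~ odd k -> ~~ odd (h k).
  move=> ek; apply/negP=> ohk; have := hs_up k ek; rewrite !permM hM.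
  have := s_up (mate (h k)); rewrite odd_mate ohk mateK => /(_ isT); lia.
move=> ei; split; first exact: h_even.
have [k def_i] : {k | nat_of_ord i = k.*2} by exists i./2; lia.
elim: k i ei def_i => [|k IHk] i ei def_i; first by rewrite def_i.
have lt_k : (k.*2 < p)%N by have := ltn_ord i; lia.
pose j := Ordinal lt_k; have ej : ~~ odd j by rewrite /=; lia.
have := IHk j ej erefl; have := hs_incr j i ej ei; rewrite !permM => lt_s.
have {}lt_s : (s (h j) < s (h i))%N by apply: lt_s; rewrite /= def_i; lia.
have := h_even _ ej; have := h_even _ ei.
case: (ltngtP (h j) (h i)) => [||/val_inj eq_h].
- by rewrite /=; lia.
- by move=> lt ei' ej'; have := s_incr _ _ ei' ej' lt; lia.
- by rewrite eq_h ltnn in lt_s.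
Qed.

(** Apply [normal_pair_ge] to h and to its inverse: h fixes every even
    position, hence also their mates. *)
Lemma normal_pair_uniq s h :
  pair_perm h -> normal s -> normal (h * s) -> h = 1%g.
Proof.
move=> hM ns nhs.
have fix_even i : ~~ odd i -> h i = i.
  move=> ei; have [ehi le_ih] := normal_pair_ge hM ns nhs ei.
  have ns' : normal (h^-1 * (h * s)) by rewrite mulKg.
  have [_] := normal_pair_ge (pair_permV hM) nhs ns' ehi.
  by rewrite permK => le_hi; apply: val_inj; apply/eqP; rewrite eqn_leq le_hi.
apply/permP=> i; rewrite perm1.
case: (boolP (odd i)) => [oi|]; last exact: fix_even.
by rewrite -{1}(mateK i) (pair_permP _ hM) fix_even ?mateK // odd_mate oi.
Qed.

(** * The Pfaffian as a sum over normal permutations *)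

Section Terms.

Variable K : comNzRingType.
Implicit Type M : 'M[K]_p.

(** The vanishing of the diagonal does not follow from antisymmetry when 2 is a
    zero divisor. *)
Definition alternating M : Prop :=
  (forall i, M i i = 0) /\ (forall i j, M i j = - M j i).

Definition pf_term M s : K :=
  (-1) ^+ s * \prod_(i : 'I_p | ~~ odd i) M (s i) (s (ordS i)).

Lemma pfaffianE M : pfaffian M = \sum_(s | normal s) pf_term M s.
Proof. by rewrite /pfaffian (negbTE p_even). Qed.

Lemma pf_term_flip M s i :
    alternating M -> ~~ odd i ->
  pf_term M (tperm i (mate i) * s) = pf_term M s.
Proof.
move=> [_ Manti] ei; rewrite /pf_term odd_permM odd_tperm mate_neq addTb signrN.
rewrite [in LHS](bigD1 i) //= [in RHS](bigD1 i) //= !permM !ordS_mate //.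
rewrite tpermL tpermR Manti !(mulNr, mulrN) opprK; congr (_ * (_ * _)).
apply: eq_bigr => k /andP[ek neq]; rewrite !permM !ordS_mate //.
have ik : i != k by rewrite eq_sym.
by rewrite !tpermD ?(inj_eq mate_inj) ?even_neq_mate // eq_sym even_neq_mate.
Qed.

Lemma pf_term_swap M s i j :
    ~~ odd i -> ~~ odd j -> i != j ->
  pf_term M (swap_pairs i j * s) = pf_term M s.
Proof.
move=> ei ej neq; rewrite /pf_term !odd_permM !odd_tperm (inj_eq mate_inj) neq /=.
congr (_ * _); rewrite [in RHS](reindex_inj (@perm_inj _ (tperm i j))) /=.
apply: eq_big => [k|k ek].
  by case: tpermP => // ->; rewrite (negbTE ei) (negbTE ej).
have ek' : ~~ odd (tperm i j k) by case: tpermP.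
rewrite !(permM _ s) !ordS_mate // (pair_permP _ (pair_perm_swap ei ej)).
by rewrite swap_pairs_even.
Qed.

(** The coefficients p - i are positive and decreasing in i, so that
    exchanging the values of s on a pair not listed increasingly, or swapping
    two pairs listed in the wrong order, lowers the weight.  A permutation of
    least weight among those of a given matching is therefore normal. *)
Definition weight s : nat := (\sum_(i : 'I_p | ~~ odd i) s i * (p - i))%N.

Lemma weight_flip s i :
    ~~ odd i -> (s (mate i) < s i)%N ->
  (weight (tperm i (mate i) * s) < weight s)%N.
Proof.
move=> ei lt; rewrite /weight (bigD1 i) //= [X in (_ < X)%N](bigD1 i) //=.
rewrite permM tpermL (eq_bigr (fun k => s k * (p - k))%N) => [|k /andP[ek neq]].
  by rewrite ltn_add2r ltn_pmul2r // subn_gt0.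
by rewrite permM tpermD // eq_sym // even_neq_mate.
Qed.

Lemma weight_swap s i j :
    ~~ odd i -> ~~ odd j -> (i < j)%N -> (s j < s i)%N ->
  (weight (swap_pairs i j * s) < weight s)%N.
Proof.
move=> ei ej ltij lt; have neq : j != i by apply: contraTneq ltij => ->; rewrite ltnn.
have ej' : ~~ odd j && (j != i) by rewrite ej.
rewrite /weight (bigD1 i) //= (bigD1 j) //=.
rewrite [X in (_ < X)%N](bigD1 i) //= [X in (_ < _ + X)%N](bigD1 j) //=.
rewrite !(permM _ s) !swap_pairs_even // tpermL tpermR.
rewrite (eq_bigr (fun k => s k * (p - k))%N) => [|k /andP[/andP[ek ki] kj]].
  rewrite !addnA ltn_add2r; have := ltn_ord j; nia.
by rewrite (permM _ s) swap_pairs_even // tpermD // eq_sym.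
Qed.

(** Among the pair permutations h under which the term of s is unchanged, take
    one minimizing the weight of h * s: a defect of h * s would be removed by
    a flip or by a swap of two pairs, neither of which changes the term. *)
Lemma normalize_pairing M s :
    alternating M ->
  exists h, [/\ pair_perm h, normal (h * s) & pf_term M (h * s) = pf_term M s].
Proof.
move=> altM.
pose P h := pair_perm h && (pf_term M (h * s) == pf_term M s).
have P1 : P 1%g by rewrite /P pair_perm1 mul1g eqxx.
case: (arg_minnP (fun h => weight (h * s)) P1) => h /andP[hM /eqP term_h] h_min.
exists h; split=> //.
have no_descent g : pair_perm g ->
    pf_term M (g * (h * s)) = pf_term M (h * s) ->
    (weight (h * s) <= weight (g * (h * s)))%N.
  move=> gM term_g; rewrite mulgA; apply: h_min.
  by rewrite /P pair_permM // -mulgA term_g term_h eqxx.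
apply/normalP; split=> [i ei|i j ei ej ltij]; rewrite ltnNge leq_eqVlt negb_or.
  rewrite -leqNgt (inj_eq val_inj) (inj_eq perm_inj) eq_sym mate_neq /=.
  rewrite leqNgt; apply/negP => /(weight_flip ei).
  by rewrite ltnNge no_descent ?pair_perm_flip ?pf_term_flip.
have neq : i != j by apply: contraTneq ltij => ->; rewrite ltnn.
rewrite (inj_eq val_inj) (inj_eq perm_inj) eq_sym neq /=.
apply/negP => /(weight_swap ei ej ltij).
by rewrite ltnNge no_descent ?pair_perm_swap ?pf_term_swap.
Qed.

(** * Row and column operations *)

Lemma pfaffian_eq_rows M i j :
  alternating M -> i != j -> (forall k, M i k = M j k) -> pfaffian M = 0.
Proof.
move=> altM neq eqM; have [M0 Manti] := altM.
have Mij : M i j = 0 by rewrite eqM.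
have Mt a b : M (tperm i j a) (tperm i j b) = M a b.
  have row_eq a' c : M (tperm i j a') c = M a' c by case: tpermP => // ->.
  by rewrite row_eq Manti row_eq -Manti.
have term_t s : pf_term M (s * tperm i j) = - pf_term M s.
  rewrite /pf_term odd_permM odd_tperm neq addbT signrN mulNr.
  by congr (- (_ * _)); apply: eq_bigr => k _; rewrite !permM Mt.
pose N s h :=
  [&& pair_perm h, normal (h * s) & pf_term M (h * s) == pf_term M s].
pose eta s : 'S_p := odflt 1%g [pick h | N s h].
have etaP s : N s (eta s).
  rewrite /eta; case: pickP => [//|noN].
  have [h [hM nh /eqP term_h]] := normalize_pairing s altM.
  by have := noN h; rewrite /N hM nh term_h.
pose iota s := (eta (s * tperm i j) * (s * tperm i j))%g.
rewrite pfaffianE; apply: (@sum_sign_reversing _ _ (normal) iota) => s.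
- by case/and3P: (etaP (s * tperm i j)%g).
- rewrite unfold_in => ns; rewrite {1}/iota.
  case/and3P: (etaP (iota s * tperm i j)%g); set h' := eta _ => h'M nh' _.
  case/and3P: (etaP (s * tperm i j)%g) => hM nh _.
  move: nh'; rewrite {1 2}/iota; set h := eta _ in hM nh *.
  rewrite -!mulgA tperm2 mulg1 mulgA => nh'.
  by rewrite (normal_pair_uniq (pair_permM h'M hM) ns nh') mul1g.
- move=> _; rewrite -term_t.
  by case/and3P: (etaP (s * tperm i j)%g) => _ _ /eqP.
- move=> _ fix_s; case/and3P: (etaP (s * tperm i j)%g) => hM _ _.
  move: fix_s; rewrite /iota; set h := eta _ in hM *; move/permP => fix_s.
  (* A fixed point s means that transposing i and j preserves the matching
     of s.  This forces i and j to be matched, and then the term contains the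
     factor M i j = 0. *)
  pose x := (s^-1 j)%g; have sx : s x = j by rewrite permKV.
  have shx : s (h x) = i.
    have := fix_s x; rewrite !permM sx => /(congr1 (tperm i j)).
    by rewrite tpermK tpermR.
  have smx : s (mate x) = i.
    apply: contraTeq (neq) => smx_neq; rewrite negbK -shx -sx.
    have smx_neqj : s (mate x) != j.
      by rewrite -sx (inj_eq perm_inj) eq_sym mate_neq.
    have := fix_s (mate x); rewrite !permM (pair_permP _ hM).
    move/(congr1 (tperm i j)); rewrite tpermK [RHS]tpermD 1?eq_sym //.
    by move/perm_inj/mate_inj->.
  rewrite /pf_term; case: (boolP (odd x)) => [ox|ex].
    have emx : ~~ odd (mate x) by rewrite odd_mate ox.
    by rewrite (bigD1 (mate x)) //= ordS_mate // mateK smx sx Mij mul0r mulr0.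
  by rewrite (bigD1 x) //= ordS_mate // smx sx Manti Mij oppr0 mul0r mulr0.
Qed.

(** Exactly one factor of each term involves the index i, so the Pfaffian of
    M' is that of M plus c times that of N, the matrix M with row and column i
    overwritten by row and column n.  Rows i and n of N agree. *)
Lemma pfaffian_transvection M M' i n c :
    alternating M -> i != n ->
    (forall a b, M' a b =
       M a b + c * ((a == i)%:R * M n b + (b == i)%:R * M a n)) ->
  pfaffian M' = pfaffian M.
Proof.
move=> altM neq def_M'; have [M0 Manti] := altM.
pose g a := if a == i then n else a.
pose N : 'M[K]_p := \matrix_(a, b) M (g a) (g b).
have altN : alternating N.
  by split=> [a|a b]; rewrite !mxE.
have -> : pfaffian M' = pfaffian M + c * pfaffian N.
  rewrite !pfaffianE mulr_sumr -big_split /=; apply: eq_bigr => s _.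
  rewrite /pf_term mulrCA -mulrDr; congr (_ * _).
  pose x := (s^-1 i)%g; have sx : s x = i by rewrite permKV.
  have s_neq k : k != x -> s k != i by rewrite -sx (inj_eq perm_inj).
  (* The factor involving i is the one indexed by e. *)
  pose e := if odd x then mate x else x.
  have ee : ~~ odd e by rewrite /e; case: ifP => [ox|->//]; rewrite odd_mate ox.
  rewrite (bigD1 e) //= [in RHS](bigD1 e) //= [X in _ + c * X](bigD1 e) //=.
  have others k : ~~ odd k -> k != e -> s k != i /\ s (mate k) != i.
    move=> ek; rewrite /e; case: ifP => ox neq_k; split; apply: s_neq.
    - by apply: contraNneq ek => ->.
    - by apply: contraNneq neq_k => <-; rewrite mateK.
    - by [].
    - by apply: contraFneq ox => <-; rewrite odd_mate.
  have eqN : \prod_(k < p | ~~ odd k && (k != e)) N (s k) (s (ordS k)) =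
             \prod_(k < p | ~~ odd k && (k != e)) M (s k) (s (ordS k)).
    apply: eq_bigr => k /andP[ek ke]; rewrite ordS_mate //.
    by have [s1 s2] := others k ek ke; rewrite !mxE /g (negbTE s1) (negbTE s2).
  have eqM' : \prod_(k < p | ~~ odd k && (k != e)) M' (s k) (s (ordS k)) =
              \prod_(k < p | ~~ odd k && (k != e)) M (s k) (s (ordS k)).
    apply: eq_bigr => k /andP[ek ke]; rewrite ordS_mate // def_M'.
    have [s1 s2] := others k ek ke.
    by rewrite (negbTE s1) (negbTE s2) !mul0r addr0 mulr0 addr0.
  rewrite eqN eqM' mulrA -mulrDl; congr (_ * _); rewrite ordS_mate // def_M' !mxE.
  have smx : (s (mate x) == i) = false.
    by apply: negbTE; apply: s_neq; rewrite eq_sym mate_neq.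
  rewrite /g /e; case: ifP => _; rewrite ?mateK sx smx eqxx;
    by rewrite mul1r mul0r ?addr0 ?add0r.
rewrite (pfaffian_eq_rows altN neq) ?mulr0 ?addr0 // => k.
by rewrite !mxE /g eqxx; case: (n =P i).
Qed.

(** The rows are treated one at a time, in a list r.  Since v n = 0 and
    M n n = 0, row n is never altered, so each step is a transvection by the
    original row n. *)
Lemma pfaffian_add_multiples M n (v : 'I_p -> K) :
    alternating M -> v n = 0 ->
  pfaffian (\matrix_(a, b) (M a b + v a * M n b + v b * M a n)) = pfaffian M.
Proof.
move=> altM vn0; have [M0 Manti] := altM.
pose w (r : seq 'I_p) a := if a \in r then v a else 0.
pose Mr r : 'M[K]_p := \matrix_(a, b) (M a b + w r a * M n b + w r b * M a n).
have altMr r : alternating (Mr r).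
  split=> [a|a b]; rewrite !mxE; first by rewrite M0 (Manti a n); ring.
  by rewrite (Manti a b) (Manti a n) (Manti b n); ring.
suff IH r : uniq r -> pfaffian (Mr r) = pfaffian M.
  rewrite -(IH (enum 'I_p)) ?enum_uniq //; congr pfaffian.
  by apply/matrixP=> a b; rewrite !mxE /w !mem_enum.
elim: r => [|i r IHr] /= => [_|/andP[i_r /IHr{IHr} <-]].
  by congr pfaffian; apply/matrixP=> a b; rewrite !mxE /w !mul0r !addr0.
have def_w a : w (i :: r) a = w r a + v i * (a == i)%:R.
  rewrite /w in_cons; have [->|_] := eqVneq a i.
    by rewrite (negbTE i_r) add0r mulr1.
  by rewrite mulr0 addr0.
have [eq_in|neq] := eqVneq i n.
  congr pfaffian; apply/matrixP=> a b.
  by rewrite !mxE !def_w eq_in vn0 !mul0r !addr0.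
apply: (pfaffian_transvection (c := v i) (altMr r) neq) => a b.
have wn : w r n = 0 by rewrite /w vn0 if_same.
by rewrite !mxE !def_w wn M0; ring.
Qed.

End Terms.

End Pfaffian.

Lemma rmorph_pfaffian (K L : comNzRingType) (phi : {rmorphism K -> L}) p
    (M : 'M[K]_p) :
  phi (pfaffian M) = pfaffian (map_mx phi M).
Proof.
rewrite /pfaffian; case: ifP => _; first exact: rmorph0.
rewrite rmorph_sum; apply: eq_bigr => s _ /=.
rewrite rmorphM /= rmorph_sign rmorph_prod; congr (_ * _).
by apply: eq_bigr => i _; rewrite mxE.
Qed.

(** * Shifting the variables G' *)

Section Shift.

Variables (K : comNzRingType) (m : nat) (f : 'I_m -> K).

Local Notation gpoly := {mpoly K[#|gvar m|]}.

Lemma insub_neg_lt (i j : 'I_m) : (j <= i)%N ->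
  insub (i, j) = None :> option {ij : 'I_m * 'I_m | (ij.1 < ij.2)%N}.
Proof. by move=> le; rewrite insubF //= ltnNge le. Qed.

Lemma Gvar_sym (i j : 'I_m) : Gvar K i j = Gvar K j i.
Proof.
rewrite /Gvar; case: insubP => [u _ def_u|]; case: insubP => [v _ def_v|] //=.
have := valP u; have := valP v; rewrite def_u def_v /= => le1 le2.
have eq_ij : i = j by apply/val_inj/eqP; rewrite eqn_leq le1 le2.
by move: def_u def_v; rewrite eq_ij => <- /val_inj->.
Qed.

Lemma Gpvar_anti (i j : 'I_m) : Gpvar K i j = - Gpvar K j i.
Proof.
rewrite /Gpvar.
case: (ltngtP i j) => [lt|lt|/val_inj ->].
- rewrite (insub_neg_lt (ltnW lt)).
  by case: insubP => [u _ _|]; rewrite ?opprK ?oppr0.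
- rewrite (insub_neg_lt (ltnW lt)).
  by case: insubP => [u _ _|]; rewrite ?opprK ?oppr0.
- by rewrite !insub_neg_lt // oppr0.
Qed.

Lemma Gpvar_diag (i : 'I_m) : Gpvar K i i = 0.
Proof. by rewrite /Gpvar !insub_neg_lt. Qed.

Lemma shift_gvarX v : shift_Gp f (gvarX K v) = shift_var f v.
Proof. by rewrite /shift_Gp comp_mpolyXU -tnth_nth tnth_mktuple enum_rankK. Qed.

Lemma shift_Gvar i j : shift_Gp f (Gvar K i j) = Gvar K i j.
Proof.
rewrite /Gvar; case: insubP => [u _ _|_]; first by rewrite shift_gvarX.
case: insubP => [u _ _|_]; first by rewrite shift_gvarX.
exact: comp_mpoly0.
Qed.

Lemma shift_Gpvar i j :
  shift_Gp f (Gpvar K i j) = Gpvar K i j + (f i)%:MP - (f j)%:MP.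
Proof.
have lt_case (a b : 'I_m) : (a < b)%N ->
    shift_Gp f (Gpvar K a b) = Gpvar K a b + (f a)%:MP - (f b)%:MP.
  by move=> lt; rewrite /Gpvar insubT /= shift_gvarX.
case: (ltngtP i j) => [/lt_case//|lt|/val_inj->]; last first.
  by rewrite Gpvar_diag /shift_Gp comp_mpoly0 add0r subrr.
rewrite Gpvar_anti /shift_Gp comp_mpolyN -/(shift_Gp f _) lt_case //.
by rewrite !opprD opprK addrAC.
Qed.

(** The multiple of the row of the sink that is added to the row of the symbol.
    It is 0 at dotted symbols, so the row of the sink itself stays fixed. *)
Definition symbol_shift (a : symbol * 'I_m.+1) : gpoly :=
  match a.1, unlift ord_max a.2 with
  | Odot, _ | _, None => 0
  | _, Some i => (f i)%:MP
  end.

Lemma Gentry_alt (a : symbol * 'I_m.+1) : Gentry K a a = 0.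
Proof.
have G0 : Gpnode K a.2 a.2 = 0.
  by rewrite /Gpnode; case: unlift => // i; rewrite Gpvar_diag.
by rewrite /Gentry; case: a.1; rewrite ?G0 //=; ring.
Qed.

Lemma Gentry_anti (a b : symbol * 'I_m.+1) : Gentry K a b = - Gentry K b a.
Proof.
have Gs : Gnode K a.2 b.2 = Gnode K b.2 a.2.
  by rewrite /Gnode; do 2 case: unlift => //; move=> i j; exact: Gvar_sym.
have Gp : Gpnode K a.2 b.2 = - Gpnode K b.2 a.2.
  rewrite /Gpnode; do 2 case: unlift => [?|]; rewrite ?oppr0 //.
  exact: Gpvar_anti.
by rewrite /Gentry; case: a.1; case: b.1; rewrite ?Gs ?Gp /=; ring.
Qed.

Definition sink : symbol * 'I_m.+1 := (Odot, ord_max).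

Definition is_dot (a : symbol) : bool := if a is Odot then true else false.

(** For an undotted symbol labelled n, [shift_Gentry] would fail: its entries
    contain no G' to be shifted, but the operations with the sink alter them.
    In a bar string only the dotted symbol of the sink has the label n. *)
Definition sink_label_dotted (a : symbol * 'I_m.+1) : Prop :=
  a.2 = ord_max -> a.1 = Odot.

Lemma shift_Gnode i j : shift_Gp f (Gnode K i j) = Gnode K i j.
Proof.
rewrite /Gnode; case: (unlift ord_max i) => [i'|]; last exact: comp_mpoly1.
case: (unlift ord_max j) => [j'|]; [exact: shift_Gvar | exact: comp_mpoly1].
Qed.

(** Between two undotted symbols the entries [Gentry K sink b] and
    [Gentry K a sink] are -1 and 1, so the two corrections add up to the change
    - (f i - f j) caused by the shift.  If a symbol is dotted, its own multiple
    is 0, and so is the entry between it and the sink. *)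
Lemma shift_Gentry a b :
    sink_label_dotted a -> sink_label_dotted b ->
  shift_Gp f (Gentry K a b) =
    Gentry K a b + symbol_shift a * Gentry K sink b
                 + symbol_shift b * Gentry K a sink.
Proof.
have dot_dec s : {s = Odot} + {s <> Odot} by case: s; [right|right|right|left].
have not_dot c : sink_label_dotted c -> c.1 <> Odot -> {i | c.2 = lift ord_max i}.
  move=> c_in c_dot.
  by case: (unliftP ord_max c.2) => [i ->|/c_in//]; exists i.
have symbol_shiftE s i : s <> Odot -> symbol_shift (s, lift ord_max i) = (f i)%:MP.
  by rewrite /symbol_shift /= liftK; case: s.
have Gnode_sinkl i : Gnode K ord_max i = 1 by rewrite /Gnode unlift_none.
have Gnode_sinkr i : Gnode K i ord_max = 1.
  by rewrite /Gnode unlift_none; case: unlift.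
have shiftN q : shift_Gp f (- q) = - shift_Gp f q by apply: comp_mpolyN.
case: a b => [sa la] [sb lb] a_in b_in.
case: (dot_dec sa) (a_in) => [-> _|sa_circ /not_dot/(_ sa_circ)[i /= ->]].
  rewrite [symbol_shift (Odot, la)]/symbol_shift mul0r addr0.
  rewrite [Gentry _ _ sink]/Gentry mulr0 addr0 /Gentry /=.
  case: sb {b_in}; rewrite ?shiftN ?shift_Gnode //; exact: comp_mpoly0.
case: (dot_dec sb) (b_in) => [-> _|sb_circ /not_dot/(_ sb_circ)[j /= ->]].
  rewrite [symbol_shift (Odot, lb)]/symbol_shift mul0r addr0.
  rewrite [Gentry _ sink _]/Gentry mulr0 addr0 /Gentry /=.
  by case: sa sa_circ {a_in}; rewrite ?shift_Gnode.
rewrite !symbol_shiftE //.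
have -> : Gentry K sink (sb, lift ord_max j) = -1.
  by rewrite /Gentry /= Gnode_sinkl; case: sb sb_circ {b_in}.
have -> : Gentry K (sa, lift ord_max i) sink = 1.
  by rewrite /Gentry /= Gnode_sinkr; case: sa sa_circ {a_in}.
have -> : Gentry K (sa, lift ord_max i) (sb, lift ord_max j) =
    - Gpvar K i j + Gvar K i j * ((is_plus sa)%:R - (is_plus sb)%:R
                                  - (is_minus sa)%:R + (is_minus sb)%:R).
  rewrite /Gentry /Gpnode /Gnode !liftK.
  by case: sa sb sa_circ sb_circ {a_in b_in} => [] [].
rewrite {1}/shift_Gp rmorphD rmorphN rmorphM rmorphD !rmorphB /= !rmorph_nat.
by rewrite -!/(shift_Gp f _) shift_Gpvar shift_Gvar; ring.
Qed.

Lemma shift_pfaffian (mu : (m.+1).-tuple letter) :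
    tnth mu ord_max = Lsink ->
  shift_Gp f (pfaffian (Gmatrix K mu)) = pfaffian (Gmatrix K mu).
Proof.
move=> mu_sink.
rewrite /shift_Gp rmorph_pfaffian.
case: (boolP (odd (size (bar_string mu)))) => [odd_p|even_p].
  by rewrite /pfaffian odd_p.
pose sym := tnth (in_tuple (bar_string mu)).
have sym_dotted i : sink_label_dotted (sym i).
  have /all_tnthP/(_ i) : all (fun a : symbol * 'I_m.+1 =>
      (a.2 == ord_max) ==> is_dot a.1) (in_tuple (bar_string mu)).
    rewrite /= /bar_string; elim: (enum _) => //= l r IHr; rewrite all_cat {}IHr andbT.
    have [->|neq] := eqVneq l ord_max; first by rewrite mu_sink /= implybT.
    by case: (tnth mu l); rewrite /= ?(negbTE neq).
  by rewrite -/(sym i) => /implyP dotted /eqP/dotted; case: (sym i).1.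
have [n sym_n] : exists n, sym n = sink.
  have /has_tnthP[n /andP[/eqP]] : has (fun a : symbol * 'I_m.+1 =>
      (a.2 == ord_max) && is_dot a.1) (in_tuple (bar_string mu)).
    have := mem_enum 'I_m.+1 ord_max; rewrite /= /bar_string inE.
    elim: (enum _) => //= l r IHr; rewrite has_cat inE => /orP[/eqP <-|/IHr->].
      by rewrite mu_sink /= eqxx.
    exact: orbT.
  by rewrite -/(sym n) => n_label n_dot; exists n; move: n_label n_dot;
    case: (sym n) => [[] l] //= ->.
have altG : alternating (Gmatrix K mu).
  by split=> [i|i j]; rewrite !mxE; [exact: Gentry_alt | exact: Gentry_anti].
rewrite -[RHS](pfaffian_add_multiples (v := symbol_shift \o sym) even_p altG (n := n));
  last by rewrite /= sym_n.
congr pfaffian; apply/matrixP=> i j; rewrite !mxE /= -!/(sym _) sym_n.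
exact: shift_Gentry.
Qed.

End Shift.

(** * Invariance of the G-G'-polynomial *)

Theorem corollary1p3 (R : realType) (K : comNzRingType) (m : nat)
  (hm : (1 <= m)%N)
  (tau : {set {set 'I_m.+1}})
  (htau : partition tau [set: 'I_m.+1])
  (hlast : [set ord_max] \notin tau)
  (c : {set {set 'I_m.+1}} -> int)
  (hc : annular_expansion R tau c)
  (f : 'I_m -> K) :
  shift_Gp f (GG_polynomial K c) = GG_polynomial K c.
Proof.
rewrite /GG_polynomial {1}/shift_Gp rmorph_sum; apply: eq_bigr => rho _ /=.
rewrite rmorphM /= rmorph_int rmorph_sum; congr (_ * _).
apply: eq_bigr => mu /and3P[/and4P[/eqP mu_sink _ _ _] _ _] /=.
by rewrite rmorphM /= rmorph_nat -/(shift_Gp f _) shift_pfaffian.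
Qed.
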